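(* Let $d\ge1$, $\mathcal W=\{w\in\mathbb R^d:\|w\|\le1\}$, $\mathcal Z=\{-1/\sqrt d,1/\sqrt d\}^d$, $f(w,z)=\|w-z\|^2$, and let $\mathcal D=\{D(p):p\in[-1/3,1/3]^d\}$, where under $D(p)$ the coordinates $z(1),\dots,z(d)$ are independent, take values in $\{\pm1/\sqrt d\}$, and $\mathbb E[z(t)]=p(t)/\sqrt d$. Then: (i) for every algorithm $A$ (with discrete output in $\mathcal W$) and every $m>3$, there exists $D\in\mathcal D$ such that if $S\sim D^m$ and $\Delta_S(w_S)\le 1/54$, then \[ I(w_S;S)=\tilde\Omega\!\left(\frac{d}{\big(m\,\mathbb E[\Delta_S(w_S)]+1\big)^5}\right);\] (ii) for every algorithm $A$ and every $D\in\mathcal D$, with $S\sim D^m$, \[ \mathbb E[\Delta_D(w_S)]=\tilde O\!\left(\mathbb E[\Delta_S(w_S)]+\frac1m\right).\] Here $\tilde\Omega,\tilde O$ hide absolute constants and polylogarithmic factors.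
   Context: For a distribution $D$ on $\mathcal Z$, $L_D(w)=\mathbb E_{z\sim D}[f(w,z)]$ and $\Delta_D(w)=L_D(w)-\min_{w'\in\mathcal W}L_D(w')$. For a sample $S=(z_1,\dots,z_m)$, $\Delta_S(w)=\frac1m\sum_{i=1}^m f(w,z_i)-\min_{w'\in\mathcal W}\frac1m\sum_{i=1}^m f(w',z_i)$. An algorithm $A$ maps a sample $S$ to (a possibly random) $w_S\in\mathcal W$. All random variables are discrete; $I(X;Y)=\mathbb E_Y[\mathrm{KL}(P_{X\mid Y}\,\|\,P_X)]$ is the mutual information. *)

(* Defs.v *)
From mathcomp Require Import all_boot all_order all_algebra.
From mathcomp Require Import all_classical all_reals all_analysis.
Set Implicit Arguments. Unset Strict Implicit. Unset Printing Implicit Defensive.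
Import Order.TTheory GRing.Theory Num.Theory.
Local Open Scope ring_scope.
Local Open Scope classical_set_scope.

Definition sqnorm (R : realType) (d : nat) (w : 'rV[R]_d) : R :=
  \sum_(i < d) (w ord0 i) ^+ 2.

Definition Wball (R : realType) (d : nat) : set 'rV[R]_d :=
  [set w | sqnorm w <= 1].

Definition zcube (d : nat) := {ffun 'I_d -> bool}.
Definition zpt (R : realType) (d : nat) (s : zcube d) : 'rV[R]_d :=
  \row_i ((if s i then 1 else -1) / Num.sqrt (d%:R)).

Definition floss (R : realType) (d : nat) (w : 'rV[R]_d) (s : zcube d) : R :=
  sqnorm (w - zpt R s).

(* D(p): independent coordinates, P(z(t) = 1/sqrt d) = (1 + p t)/2,
   so that E[z(t)] = p(t)/sqrt d. *)
Definition Dprob (R : realType) (d : nat) (p : 'I_d -> R) (s : zcube d) : R :=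
  \prod_(t < d) ((1 + (if s t then p t else - p t)) / 2).

Definition pcube (R : realType) (d : nat) : set ('I_d -> R) :=
  [set p | forall t, - (1 / 3) <= p t <= 1 / 3].

Definition sample (d m : nat) := {ffun 'I_m -> zcube d}.
Definition Dm (R : realType) (d m : nat) (p : 'I_d -> R) (S : sample d m) : R :=
  \prod_(i < m) Dprob p (S i).

Definition LD (R : realType) (d : nat) (p : 'I_d -> R) (w : 'rV[R]_d) : R :=
  \sum_(s : zcube d) Dprob p s * floss w s.
Definition DeltaD (R : realType) (d : nat) (p : 'I_d -> R) (w : 'rV[R]_d) : R :=
  LD p w - inf [set LD p w' | w' in @Wball R d].

Definition LS (R : realType) (d m : nat) (S : sample d m) (w : 'rV[R]_d) : R :=
  (\sum_(i < m) floss w (S i)) / m%:R.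
Definition DeltaS (R : realType) (d m : nat) (S : sample d m) (w : 'rV[R]_d) : R :=
  LS S w - inf [set LS S w' | w' in @Wball R d].

Definition is_pmf (R : realType) (d : nat) (q : 'rV[R]_d -> R) : Prop :=
  [/\ forall w, 0 <= q w,
      forall w, q w != 0 -> @Wball R d w,
      countable [set w | q w != 0]
    & (\esum_(w in setT) (q w)%:E = 1)%E].

(* a (possibly randomized) algorithm with discrete output in W, on samples
   of size m: A S is the conditional law of w_S given S *)
Definition algorithm (R : realType) (d m : nat)
  (A : sample d m -> 'rV[R]_d -> R) : Prop := forall S, is_pmf (A S).

(* E[g(S, w_S)] for a nonnegative g, S ~ D(p)^m, w_S ~ A S *)
Definition Expect (R : realType) (d m : nat) (p : 'I_d -> R)
  (A : sample d m -> 'rV[R]_d -> R) (g : sample d m -> 'rV[R]_d -> R) : \bar R :=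
  (\sum_(S : sample d m) (Dm p S)%:E * \esum_(w in setT) (A S w * g S w)%:E)%E.

Definition ExpDeltaS (R : realType) (d m : nat) (p : 'I_d -> R)
  (A : sample d m -> 'rV[R]_d -> R) : \bar R :=
  Expect p A (fun S w => DeltaS S w).
Definition ExpDeltaD (R : realType) (d m : nat) (p : 'I_d -> R)
  (A : sample d m -> 'rV[R]_d -> R) : \bar R :=
  Expect p A (fun S w => DeltaD p w).

Definition Pw (R : realType) (d m : nat) (p : 'I_d -> R)
  (A : sample d m -> 'rV[R]_d -> R) (w : 'rV[R]_d) : R :=
  \sum_(S : sample d m) Dm p S * A S w.

Definition KL (R : realType) (d : nat) (q r : 'rV[R]_d -> R) : \bar R :=
  (\esum_(w in setT) (Num.max (q w * ln (q w / r w)) 0)%:E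
   - \esum_(w in setT) (Num.max (- (q w * ln (q w / r w))) 0)%:E)%E.

Definition MI (R : realType) (d m : nat) (p : 'I_d -> R)
  (A : sample d m -> 'rV[R]_d -> R) : \bar R :=
  (\sum_(S : sample d m) (Dm p S)%:E * KL (A S) (Pw p A))%E.

(* Main.v *)
Require Import Defs.
From mathcomp Require Import all_boot all_order all_algebra.
From mathcomp Require Import all_classical all_reals all_analysis.
From mathcomp Require Import ring lra.
From mathcomp Require polyrcf.
Set Implicit Arguments. Unset Strict Implicit. Unset Printing Implicit Defensive.
Import Order.TTheory GRing.Theory Num.Theory.
Local Open Scope ring_scope.
Local Open Scope classical_set_scope.

(* In the coordinates W = sqrt d w the excess risks are the mean squared distances
   of W to the empirical bias vector (Delta_S) and to p (Delta_D), whence (ii), since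
   the empirical biases have variance at most 1/m.
   For (i), write N_t for the sum over the sample of the centred signs of coordinate t
   and let s_t = l a_t (W_t - p_t).  The Donsker-Varadhan test function
   sum_t (s_t N_t - 4 m s_t^2) has exponential moment at most 1 when W and S are
   independent, so that I(W; S) is at least its mean under the joint law.  The
   quadratic part costs l^2 O(d (m E Delta_S + 1)).  The linear part is at least l d / 54
   for some p: up to the factor 1 - p_t^2, E_p[W_t N_t] is the derivative of E_p[W_t]
   in p_t, and with a_t = (1/9 - p_t^2) / (1 - p_t^2) an integration by parts over the
   cube has no boundary terms.  Optimising l gives I >= d / (11664 (m E Delta_S + 1)),
   without logarithms. *)

(** * Absolutely summable families of reals over an arbitrary index type *)

Section SignedSum.
Context {R : realType} {T : choiceType}.
Implicit Types f g h : T -> R.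

Definition summ f : Prop := (\esum_(x in setT) `|f x|%:E < +oo)%E.

(** The shape is that of [KL]: positive part minus negative part. This allows signed summands;
    [fine] sends an infinite part to 0. *)
Definition rsum f : R :=
  fine (\esum_(x in setT) (Num.max (f x) 0)%:E) -
  fine (\esum_(x in setT) (Num.max (- f x) 0)%:E).

Lemma esum_fin f : summ f -> (forall x, 0 <= f x) ->
  (\esum_(x in setT) (f x)%:E)%E \is a fin_num.
Proof.
move=> sf f0; rewrite ge0_fin_numE; last by apply: esum_ge0 => x _; rewrite lee_fin.
by under eq_esum do rewrite -(ger0_norm (f0 _)).
Qed.

Lemma summ_le f g : summ g -> (forall x, `|f x| <= g x) -> summ f.
Proof.
move=> sg fg; apply: le_lt_trans sg; apply: le_esum => x _.
by rewrite lee_fin (le_trans (fg x)) ?ler_norm.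
Qed.

Lemma summ_normr f : summ f -> summ (fun x => `|f x|).
Proof. by move=> sf; rewrite /summ; under eq_esum do rewrite normr_id. Qed.

Lemma summD f g : summ f -> summ g -> summ (fun x => f x + g x).
Proof.
move=> sf sg; apply: le_lt_trans (lte_add_pinfty sf sg).
rewrite -esumD; do ?by move=> x _; rewrite lee_fin.
by apply: le_esum => x _; rewrite -EFinD lee_fin ler_normD.
Qed.

Lemma summ_pos f : summ f -> summ (fun x => Num.max (f x) 0).
Proof.
move=> sf; apply: summ_le (summ_normr sf) _ => x.
by rewrite ger0_norm ?le_max ?lexx ?orbT// ge_max ler_norm normr_ge0.
Qed.

Lemma summN f : summ f -> summ (fun x => - f x).
Proof. by move=> sf; apply: summ_le (summ_normr sf) _ => x; rewrite normrN. Qed.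

Lemma summ_neg f : summ f -> summ (fun x => Num.max (- f x) 0).
Proof. by move=> /summN; exact: summ_pos. Qed.

Lemma esum_EFinZ c f : 0 <= c -> (forall x, 0 <= f x) ->
  (\esum_(x in setT) (c * f x)%:E = c%:E * \esum_(x in setT) (f x)%:E)%E.
Proof.
(* One inequality suffices: for [c > 0] the converse is [le] for the factor [c^-1] and the family
   [c * f]. *)
have le b g : 0 <= b -> (forall x, 0 <= g x) ->
    (\esum_(x in setT) (b * g x)%:E <= b%:E * \esum_(x in setT) (g x)%:E)%E.
  move=> b0 g0; apply: ge_ereal_sup => _ [X XT <-].
  under eq_fsbigr do rewrite EFinM.
  rewrite -ge0_mule_fsumr; last by move=> x; rewrite lee_fin.
  by apply: lee_wpmul2l; rewrite ?lee_fin//; apply: ereal_sup_ubound; exists X.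
move=> c0 f0; apply/eqP; rewrite eq_le le//=.
have [->|cn0] := eqVneq c 0.
  by rewrite mul0e; apply: esum_ge0 => x _; rewrite mul0r.
have cp : 0 < c by rewrite lt_neqAle eq_sym cn0.
rewrite muleC -lee_pdivlMr//.
have := le c^-1 (fun x => c * f x).
rewrite invr_ge0 c0 => /(_ isT (fun x => mulr_ge0 c0 (f0 x))).
by under eq_esum do rewrite mulKf//; rewrite muleC.
Qed.

Lemma summZ c f : summ f -> summ (fun x => c * f x).
Proof.
move=> sf; rewrite /summ; under eq_esum do rewrite normrM.
rewrite esum_EFinZ// -ge0_fin_numE; last first.
  by apply: mule_ge0; rewrite ?lee_fin//; apply: esum_ge0 => x _; rewrite lee_fin.
by rewrite fin_numM// esum_fin//; exact: summ_normr.
Qed.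

Lemma summ0 : summ (fun=> 0).
Proof. by rewrite /summ esum1 ?ltry// => x _; rewrite normr0. Qed.

Lemma summ_sum I (r : seq I) (F : I -> T -> R) :
  (forall i, summ (F i)) -> summ (fun x => \sum_(i <- r) F i x).
Proof.
move=> sF; elim: r => [|i r sr].
  by under eq_fun do rewrite big_nil; exact: summ0.
by under eq_fun do rewrite big_cons; exact: summD.
Qed.

(** Two splittings of [f] into nonnegative parts agree after cross-addition, where the sums are
    additive. Additivity of [rsum] follows by adding the parts of two families. *)
Lemma rsum_diff f g h : summ g -> summ h ->
  (forall x, 0 <= g x) -> (forall x, 0 <= h x) -> (forall x, f x = g x - h x) ->
  rsum f = fine (\esum_(x in setT) (g x)%:E) - fine (\esum_(x in setT) (h x)%:E).
Proof.
move=> sg sh g0 h0 fE.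
have sf : summ f.
  apply: summ_le (summD sg sh) _ => x.
  by rewrite fE (le_trans (ler_normB _ _))// !ger0_norm.
have p0 x : 0 <= Num.max (f x) 0 by rewrite le_max lexx orbT.
have n0 x : 0 <= Num.max (- f x) 0 by rewrite le_max lexx orbT.
apply/eqP; rewrite /rsum subr_eq addrAC eq_sym subr_eq eq_sym; apply/eqP.
have fp := esum_fin (summ_pos sf) p0; have fn := esum_fin (summ_neg sf) n0.
rewrite -!fineD ?(esum_fin sg g0) ?(esum_fin sh h0)//.
rewrite -!esumD; do ?by move=> x _; rewrite lee_fin.
congr fine; apply: eq_esum => x _; rewrite -!EFinD; congr EFin.
rewrite fE; case: (leP (g x - h x) 0) => gh.
  rewrite max_l; lra.
rewrite max_r; lra.
Qed.

Lemma ge0_rsumE f : summ f -> (forall x, 0 <= f x) ->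
  (\esum_(x in setT) (f x)%:E = (rsum f)%:E)%E.
Proof.
move=> sf f0; rewrite (rsum_diff (g := f) (h := fun=> 0))//; last 2 first.
- exact: summ0.
- by move=> x; rewrite subr0.
by rewrite [X in _ - fine X]esum1// subr0 fineK// esum_fin.
Qed.

Lemma rsumE f : summ f ->
  (\esum_(x in setT) (Num.max (f x) 0)%:E -
   \esum_(x in setT) (Num.max (- f x) 0)%:E = (rsum f)%:E)%E.
Proof.
move=> sf; rewrite /rsum EFinB !fineK//; apply: esum_fin.
- exact: summ_neg.
- by move=> x; rewrite le_max lexx orbT.
- exact: summ_pos.
- by move=> x; rewrite le_max lexx orbT.
Qed.

Let maxN (y : R) : y = Num.max y 0 - Num.max (- y) 0.
Proof. by case: (leP y 0) => ?; [rewrite max_l|rewrite max_r]; lra. Qed.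

Lemma rsumD f g : summ f -> summ g -> rsum (fun x => f x + g x) = rsum f + rsum g.
Proof.
move=> sf sg.
rewrite (rsum_diff (g := fun x => Num.max (f x) 0 + Num.max (g x) 0)
  (h := fun x => Num.max (- f x) 0 + Num.max (- g x) 0)); last 5 first.
- by apply: summD; exact: summ_pos.
- by apply: summD; exact: summ_neg.
- by move=> x; rewrite addr_ge0// le_max lexx orbT.
- by move=> x; rewrite addr_ge0// le_max lexx orbT.
- by move=> x; rewrite {1}(maxN (f x)) {1}(maxN (g x)); ring.
under eq_esum do rewrite EFinD.
under [X in _ - fine X]eq_esum do rewrite EFinD.
rewrite !esumD ?fineD; try by move=> x _; rewrite lee_fin le_max lexx orbT.
- by rewrite /rsum; ring.
all: apply: esum_fin; try by move=> x; rewrite le_max lexx orbT.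
all: by [exact: summ_pos|exact: summ_neg].
Qed.

Lemma ge0_rsumZ c f : 0 <= c -> rsum (fun x => c * f x) = c * rsum f.
Proof.
move=> c0; rewrite /rsum.
under eq_esum do rewrite -[in X in Num.max _ X](mulr0 c) -maxr_pMr//.
under [X in _ - fine X]eq_esum do
  rewrite -mulrN -[in X in Num.max _ X](mulr0 c) -maxr_pMr//.
rewrite !esum_EFinZ//.
(* Infinite [y] included: for [c > 0] the product stays infinite, and [fine] gives 0 on both
   sides. *)
suff E (y : \bar R) : fine (c%:E * y)%E = c * fine y by rewrite !E mulrBr.
have [->|cn0] := eqVneq c 0; first by rewrite mul0e mul0r.
have cp : 0 < c by rewrite lt_neqAle eq_sym cn0.
by case: y => [y||]//=; rewrite ?gt0_muley ?gt0_muleNy ?lte_fin//= mulr0.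
all: by move=> x; rewrite le_max lexx orbT.
Qed.

Lemma rsumN f : rsum (fun x => - f x) = - rsum f.
Proof. by rewrite /rsum; under [in X in _ - X]eq_esum do rewrite opprK; rewrite opprB. Qed.

Lemma rsumZ c f : rsum (fun x => c * f x) = c * rsum f.
Proof.
have [c0|/ltW c0] := leP 0 c; first exact: ge0_rsumZ.
rewrite -[c]opprK; under eq_fun do rewrite mulNr.
by rewrite rsumN ge0_rsumZ ?mulNr ?opprK// oppr_ge0.
Qed.

Lemma rsum0 : rsum (fun=> 0) = 0.
Proof.
rewrite -[RHS](mul0r (rsum (fun=> 0))) -rsumZ; congr rsum.
by apply/funext => x; rewrite mul0r.
Qed.

Lemma rsum_sum I (r : seq I) (F : I -> T -> R) :
  (forall i, summ (F i)) ->
  rsum (fun x => \sum_(i <- r) F i x) = \sum_(i <- r) rsum (F i).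
Proof.
move=> sF; elim: r => [|i r sr].
  by under eq_fun do rewrite big_nil; rewrite big_nil rsum0.
under eq_fun do rewrite big_cons.
by rewrite rsumD ?sr ?big_cons//; exact: summ_sum.
Qed.

Lemma rsum_ge0 f : (forall x, 0 <= f x) -> 0 <= rsum f.
Proof.
move=> f0; rewrite /rsum [X in _ - fine X]esum1 ?subr0.
  by apply: fine_ge0; apply: esum_ge0 => x _; rewrite lee_fin le_max lexx orbT.
by move=> x _; rewrite max_r// oppr_le0.
Qed.

Lemma le_rsum f g : summ f -> summ g -> (forall x, f x <= g x) -> rsum f <= rsum g.
Proof.
move=> sf sg fg; rewrite -subr_ge0 -rsumN -rsumD//; last exact: summN.
by apply: rsum_ge0 => x; rewrite subr_ge0.
Qed.


End SignedSum.

(** * Moments of samples of independent biased signs *)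

Section BernoulliProduct.
Context {R : realType}.

Definition bern (q : R) (x : bool) : R := (1 + (if x then q else - q)) / 2.
Definition sgb (x : bool) : R := if x then 1 else -1.

(** The [N_t] of the overview; divided by [1 - p t ^+ 2] it is the logarithmic derivative of
    [Dm p S] in [p t]. *)
Definition dev (d m : nat) (p : 'I_d -> R) (S : sample d m) (t : 'I_d) : R :=
  \sum_(i < m) (sgb (S i t) - p t).

Lemma sum_sample_prod (d m : nat) (F : 'I_m -> 'I_d -> bool -> R) :
  \sum_(S : sample d m) \prod_(i < m) \prod_(t < d) F i t (S i t) =
  \prod_(i < m) \prod_(t < d) (F i t true + F i t false).
Proof.
rewrite -(bigA_distr_bigA (fun i (s : zcube d) => \prod_(t < d) F i t (s t))).
apply: eq_bigr => i _; rewrite -bigA_distr_bigA.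
by apply: eq_bigr => t _; rewrite big_bool.
Qed.

Lemma E_sample_prod (d m : nat) (p : 'I_d -> R) (F : 'I_m -> 'I_d -> bool -> R) :
  \sum_(S : sample d m) Dm p S * \prod_(i < m) \prod_(t < d) F i t (S i t) =
  \prod_(i < m) \prod_(t < d) \sum_x bern (p t) x * F i t x.
Proof.
under [RHS]eq_bigr do under eq_bigr do rewrite big_bool.
rewrite -(sum_sample_prod (fun i t x => bern (p t) x * F i t x)).
apply: eq_bigr => S _; rewrite /Dm /Dprob -big_split/=.
by apply: eq_bigr => i _; rewrite -big_split.
Qed.

Lemma E_coord_prod (d m : nat) (p : 'I_d -> R) (t : 'I_d) (F : 'I_m -> bool -> R) :
  \sum_(S : sample d m) Dm p S * \prod_(i < m) F i (S i t) =
  \prod_(i < m) \sum_x bern (p t) x * F i x.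
Proof.
transitivity (\sum_(S : sample d m) Dm p S * \prod_(i < m) \prod_(u < d)
    (if u == t then F i (S i u) else 1)).
  apply: eq_bigr => S _; congr (_ * _); apply: eq_bigr => i _.
  by rewrite -big_mkcond big_pred1_eq.
rewrite (E_sample_prod p (fun i u x => if u == t then F i x else 1)).
apply: eq_bigr => i _; rewrite (bigD1 t)//= eqxx [X in _ * X]big1 ?mulr1// => u /negPf->.
by rewrite big_bool/= /bern; field.
Qed.

Variables (d m : nat) (p : 'I_d -> R).
Hypothesis pC : @pcube R d p.

Lemma bern_gt0 t x : 0 < bern (p t) x.
Proof. by have := pC t; rewrite /bern; case: x; lra. Qed.

Lemma Dm_gt0 (S : sample d m) : 0 < Dm p S.
Proof. by apply: prodr_gt0 => i _; apply: prodr_gt0 => t _; exact: bern_gt0. Qed.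

Lemma sum_Dm : \sum_(S : sample d m) Dm p S = 1.
Proof.
have := E_sample_prod p (fun (_ : 'I_m) (_ : 'I_d) (_ : bool) => 1 : R).
rewrite [X in _ = X]big1 => [|i _]; last first.
  by rewrite big1// => t _; rewrite big_bool/= /bern; field.
move=> <-; apply: eq_bigr => S _.
by rewrite big1 ?mulr1// => i _; rewrite big1.
Qed.

Let bern_dev0 t : \sum_x bern (p t) x * (sgb x - p t) = 0.
Proof. by rewrite big_bool/= /bern /sgb; field. Qed.

Lemma E_dev t : \sum_(S : sample d m) Dm p S * dev p S t = 0.
Proof.
under eq_bigr do rewrite /dev mulr_sumr.
rewrite exchange_big big1//= => i _.
transitivity (\sum_(S : sample d m) Dm p S *
    \prod_(k < m) (if k == i then sgb (S k t) - p t else 1)).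
  by apply: eq_bigr => S _; rewrite -big_mkcond big_pred1_eq.
rewrite (E_coord_prod p t (fun k x => if k == i then sgb x - p t else 1)).
by rewrite (bigD1 i)//= eqxx bern_dev0 mul0r.
Qed.

(** Off-diagonal products vanish by independence, and each sign has variance [1 - p t ^+ 2]. *)
Lemma E_dev_sq t : \sum_(S : sample d m) Dm p S * dev p S t ^+ 2 = m%:R * (1 - p t ^+ 2).
Proof.
pose Y (S : sample d m) i := sgb (S i t) - p t.
transitivity (\sum_i \sum_j \sum_(S : sample d m) Dm p S * (Y S i * Y S j)).
  rewrite (eq_bigr (fun S => \sum_i \sum_j Dm p S * (Y S i * Y S j))).
    by rewrite exchange_big; apply: eq_bigr => i _; rewrite exchange_big.
  move=> S _; rewrite expr2 /dev big_distrlr/= mulr_sumr.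
  by apply: eq_bigr => i _; rewrite mulr_sumr.
rewrite (eq_bigr (fun=> 1 - p t ^+ 2)); last first.
  move=> i _; rewrite (bigD1 i)//= [X in _ + X]big1 ?addr0.
  - transitivity (\sum_(S : sample d m) Dm p S *
        \prod_(k < m) (if k == i then Y S k ^+ 2 else 1)).
      by apply: eq_bigr => S _; rewrite -big_mkcond big_pred1_eq expr2.
    rewrite (E_coord_prod p t (fun k x => if k == i then (sgb x - p t) ^+ 2 else 1)).
    rewrite (bigD1 i)//= eqxx [X in _ * X]big1 ?mulr1; last first.
      by move=> k /negPf->; rewrite big_bool/= /bern; field.
    by rewrite big_bool/= /bern /sgb; field.
  - move=> j ji.
    transitivity (\sum_(S : sample d m) Dm p S *
        \prod_(k < m) ((if k == i then Y S k else 1) * (if k == j then Y S k else 1))).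
      by apply: eq_bigr => S _; rewrite big_split/= -!big_mkcond !big_pred1_eq.
    rewrite (E_coord_prod p t (fun k x => (if k == i then sgb x - p t else 1) *
       (if k == j then sgb x - p t else 1))).
    rewrite (bigD1 i)//= eqxx eq_sym (negPf ji).
    by under eq_bigr do rewrite mulr1; rewrite bern_dev0 mul0r.
by rewrite sumr_const card_ord mulr_natl.
Qed.

(** The linear term has mean zero for a centred variable, which leaves a subgaussian bound. For
    [y >= 1/2] one has [y <= 2 y^2]; for [y <= -1/2], [exp y <= 1]; in between,
    [exp y <= 1 / (1 - y)]. *)
Lemma expR_le_quad (y : R) : expR y <= y + expR (2 * y ^+ 2).
Proof.
have e2 : 1 + 2 * y ^+ 2 <= expR (2 * y ^+ 2) by exact: expR_ge1Dx.
have [y2|y2] := leP (1 / 2) y.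
  have : expR y <= expR (2 * y ^+ 2) by rewrite ler_expR; nra.
  lra.
have [ny|ny] := leP y (- (1 / 2)).
  have : expR y <= 1 by rewrite expR_le1; lra.
  nra.
have := expR_ge1Dx (- y); rewrite expRN => e1.
have : expR y <= (1 - y)^-1.
  by rewrite -[leLHS]invrK lef_pV2 ?posrE ?invr_gt0 ?expR_gt0//; lra.
move=> /le_trans; apply; apply: (le_trans _ (lerD (lexx y) e2)).
rewrite -div1r ler_pdivrMr; last lra.
nra.
Qed.

Lemma bern_mgf t (s : R) : \sum_x bern (p t) x * expR (s * (sgb x - p t)) <= expR (4 * s ^+ 2).
Proof.
have H x : bern (p t) x * expR (s * (sgb x - p t)) <=
    bern (p t) x * (s * (sgb x - p t)) + bern (p t) x * expR (4 * s ^+ 2).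
  rewrite -mulrDr ler_pM2l ?bern_gt0//; apply: le_trans (expR_le_quad _) _.
  rewrite lerD2l ler_expR exprMn.
  (* A centred sign is at most 4/3 in absolute value, and 16/9 <= 2. *)
  suff : (sgb x - p t) ^+ 2 <= 2 by have := sqr_ge0 s; nra.
  by have /andP[a b] := pC t; rewrite /sgb; case: x; nra.
apply: (le_trans (ler_sum _ (fun x _ => H x))); rewrite big_split/=.
under eq_bigr do rewrite mulrCA.
rewrite -mulr_sumr bern_dev0 mulr0 add0r -mulr_suml.
by rewrite big_bool/= /bern; lra.
Qed.

Lemma sample_mgf (s : 'I_d -> R) :
  \sum_(S : sample d m) Dm p S * expR (\sum_t s t * dev p S t) <=
  expR (4 * m%:R * \sum_t s t ^+ 2).
Proof.
rewrite (eq_bigr (fun S => Dm p S * \prod_(i < m) \prod_(t < d)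
    expR (s t * (sgb (S i t) - p t)))); last first.
  move=> S _; congr (_ * _); rewrite exchange_big/= expR_sum.
  by apply: eq_bigr => t _; rewrite /dev mulr_sumr expR_sum.
rewrite (E_sample_prod p (fun i t x => expR (s t * (sgb x - p t)))).
apply: (@le_trans _ _ (\prod_(i < m) \prod_(t < d) expR (4 * s t ^+ 2))).
  apply: ler_prod => i _; apply/andP; split.
    apply: prodr_ge0 => t _; apply: sumr_ge0 => x _.
    by rewrite mulr_ge0 ?expR_ge0// ltW ?bern_gt0.
  apply: ler_prod => t _; rewrite bern_mgf andbT; apply: sumr_ge0 => x _.
  by rewrite mulr_ge0 ?expR_ge0// ltW ?bern_gt0.
rewrite prodr_const card_ord -expR_sum -expRM_natl -mulr_natl ler_expR.
by rewrite -mulr_sumr mulrCA mulrA.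
Qed.

End BernoulliProduct.

(** * Excess losses as mean squared distances *)

Section ExcessLoss.
Context {R : realType}.

Definition resc (d : nat) (w : 'rV[R]_d) (t : 'I_d) : R := Num.sqrt d%:R * w ord0 t.

Definition msd (d : nat) (w : 'rV[R]_d) (c : 'I_d -> R) : R :=
  (\sum_(t < d) (resc w t - c t) ^+ 2) / d%:R.

Definition emp (d m : nat) (S : sample d m) (t : 'I_d) : R :=
  (\sum_(i < m) sgb (S i t)) / m%:R.

Variable d : nat.
Hypothesis d_gt0 : (0 < d)%N.

Let dn0 : d%:R != 0 :> R. Proof. by rewrite pnatr_eq0 -lt0n. Qed.
Let d0 : 0 < d%:R :> R. Proof. by rewrite ltr0n. Qed.
Let sn0 : Num.sqrt d%:R != 0 :> R. Proof. by rewrite gt_eqF// sqrtr_gt0. Qed.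
Let ss : Num.sqrt d%:R ^+ 2 = d%:R :> R. Proof. by rewrite sqr_sqrtr// ltW. Qed.

Lemma msd_ge0 (w : 'rV[R]_d) c : 0 <= msd w c.
Proof. by rewrite divr_ge0// sumr_ge0// => t _; exact: sqr_ge0. Qed.

Lemma sqnorm_resc (w : 'rV[R]_d) : \sum_t resc w t ^+ 2 = d%:R * sqnorm w.
Proof.
by rewrite /sqnorm mulr_sumr; apply: eq_bigr => t _; rewrite exprMn ss.
Qed.

Lemma floss_msd (w : 'rV[R]_d) (s : zcube d) : floss w s = msd w (fun t => sgb (s t)).
Proof.
rewrite /floss /sqnorm /msd mulr_suml; apply: eq_bigr => t _.
by rewrite !mxE /resc /sgb -[X in _ = _ / X]ss; case: (s t); field.
Qed.

(** The point whose rescaling is [c] lies in the unit ball because every [c t ^+ 2] is at most 1,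
    and its distance to [c] is zero. *)
Lemma inf_msd (c : 'I_d -> R) (k : R) : (forall t, c t ^+ 2 <= 1) ->
  inf [set msd w c + k | w in @Wball R d] = k.
Proof.
move=> c1; set A := [set _ | _ in _].
have Ak : A k.
  exists (\row_t (c t / Num.sqrt d%:R)) => /=.
    rewrite /Wball/= -(ler_pM2l d0) -sqnorm_resc mulr1.
    rewrite -[leRHS](_ : \sum_(t < d) 1 = _); last by rewrite sumr_const card_ord.
    by apply: ler_sum => t _; rewrite /resc mxE mulrCA divff// mulr1.
  rewrite /msd big1 ?mul0r ?add0r// => t _.
  by rewrite /resc mxE mulrCA divff// mulr1 subrr expr0n.
have lbA : lbound A k by move=> _ [w _ <-]; rewrite lerDr msd_ge0.
apply/eqP; rewrite eq_le; apply/andP; split.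
  by apply: ge_inf => //; exists k.
by apply: lb_le_inf => //; exists k.
Qed.

Lemma emp_sqr_le1 m (S : sample d m) t : (0 < m)%N -> emp S t ^+ 2 <= 1.
Proof.
move=> m0; rewrite -ler_sqrt// sqrtr1 sqrtr_sqr /emp normrM normfV (ger0_norm (ler0n _ _)).
rewrite ler_pdivrMr ?ltr0n// mul1r (le_trans (ler_norm_sum _ _ _))//.
rewrite -[leRHS](_ : \sum_(i < m) 1 = _); last by rewrite sumr_const card_ord.
by apply: ler_sum => i _; rewrite /sgb; case: (S i t); rewrite ?normrN normr1.
Qed.

(** Bias-variance decomposition in each coordinate: signs square to 1, so the empirical variance is
    [1 - emp S t ^+ 2], independent of [w]. *)
Lemma LS_msd m (S : sample d m) (w : 'rV[R]_d) : (0 < m)%N ->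
  LS S w = msd w (emp S) + (\sum_t (1 - emp S t ^+ 2)) / d%:R.
Proof.
move=> m0; have mn0 : m%:R != 0 :> R by rewrite pnatr_eq0 -lt0n.
rewrite /LS; under eq_bigr do rewrite floss_msd /msd.
rewrite /msd -mulr_suml exchange_big/= -mulrDl -big_split/= mulrAC; congr (_ / _).
rewrite mulr_suml; apply: eq_bigr => t _.
have -> : \sum_(i < m) (resc w t - sgb (S i t)) ^+ 2 =
    m%:R * (resc w t ^+ 2 + 1) - 2 * resc w t * \sum_(i < m) sgb (S i t).
  rewrite mulr_sumr mulr_natl -[X in _ *+ X](card_ord m) -sumr_const -sumrB.
  by apply: eq_bigr => i _; rewrite /sgb; case: (S i t); ring.
by rewrite /emp; field.
Qed.

Lemma DeltaS_msd m (S : sample d m) (w : 'rV[R]_d) : (0 < m)%N ->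
  DeltaS S w = msd w (emp S).
Proof.
move=> m0; rewrite /DeltaS; under eq_fun do rewrite LS_msd//.
by rewrite inf_msd ?LS_msd ?addrK// => t; exact: emp_sqr_le1.
Qed.

Lemma E_coord (p : 'I_d -> R) t (F : bool -> R) :
  \sum_(s : zcube d) Dprob p s * F (s t) = \sum_x bern (p t) x * F x.
Proof.
pose G u x := bern (p u) x * (if u == t then F x else 1).
transitivity (\prod_u \sum_x G u x).
  rewrite bigA_distr_bigA; apply: eq_bigr => s _.
  by rewrite /G big_split/=; congr (_ * _); rewrite -big_mkcond big_pred1_eq.
rewrite (bigD1 t)//= [X in _ * X]big1 ?mulr1 => [|u /negPf ut].
  by apply: eq_bigr => x _; rewrite /G eqxx.
by rewrite /G ut big_bool/= /bern; field.
Qed.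

Lemma LD_msd (p : 'I_d -> R) (w : 'rV[R]_d) :
  LD p w = msd w p + (\sum_t (1 - p t ^+ 2)) / d%:R.
Proof.
rewrite /LD; under eq_bigr do rewrite floss_msd /msd mulrA mulr_sumr.
rewrite /msd -mulr_suml exchange_big/= -mulrDl -big_split/=; congr (_ / _).
apply: eq_bigr => t _; rewrite (E_coord p t (fun x => (resc w t - sgb x) ^+ 2)).
by rewrite big_bool/= /bern /sgb; field.
Qed.

Lemma DeltaD_msd (p : 'I_d -> R) (w : 'rV[R]_d) : @pcube R d p ->
  DeltaD p w = msd w p.
Proof.
move=> pC; rewrite /DeltaD; under eq_fun do rewrite LD_msd//.
rewrite inf_msd ?LD_msd ?addrK// => t.
by have /andP[] := pC t; nra.
Qed.

End ExcessLoss.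

(** * Expectations under the joint law, and lower bounds on mutual information *)

Section Algorithm.
Context {R : realType} {d m : nat}.
Hypotheses (d_gt0 : (0 < d)%N) (m_gt0 : (0 < m)%N).
Variables (p : 'I_d -> R) (A : sample d m -> 'rV[R]_d -> R).
Hypotheses (pC : @pcube R d p) (algA : algorithm A).

(** Bounded on the ball only: the laws [A S] live there, so such integrands are summable against
    them. *)
Definition bdd (g : sample d m -> 'rV[R]_d -> R) :=
  exists M, forall S w, @Wball R d w -> `|g S w| <= M.

Lemma bddD g h : bdd g -> bdd h -> bdd (fun S w => g S w + h S w).
Proof.
move=> [M gM] [N hN]; exists (M + N) => S w Bw.
by rewrite (le_trans (ler_normD _ _))// lerD ?gM ?hN.
Qed.

Lemma bddM g h : bdd g -> bdd h -> bdd (fun S w => g S w * h S w).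
Proof.
move=> [M gM] [N hN]; exists (M * N) => S w Bw.
by rewrite normrM ler_pM ?gM ?hN.
Qed.

Lemma bdd_sample (h : sample d m -> R) : bdd (fun S _ => h S).
Proof.
exists (\sum_S `|h S|) => S w _.
by rewrite (bigD1 S)//= lerDl sumr_ge0.
Qed.

Lemma bdd_sum (F : 'I_d -> sample d m -> 'rV[R]_d -> R) :
  (forall t, bdd (F t)) -> bdd (fun S w => \sum_t F t S w).
Proof.
move=> bF; elim: (index_enum _) => [|t r br].
  by under eq_fun do under eq_fun do rewrite big_nil; exact: bdd_sample.
by under eq_fun do under eq_fun do rewrite big_cons; exact: bddD.
Qed.

Lemma bdd_resc t : bdd (fun _ w => resc w t).
Proof.
exists (1 + d%:R) => _ w; rewrite /Wball/= => Bw.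
have : resc w t ^+ 2 <= d%:R.
  apply: le_trans (_ : d%:R * sqnorm w <= _); last by rewrite ler_piMr.
  by rewrite -sqnorm_resc// (bigD1 t)//= lerDl sumr_ge0// => u _; exact: sqr_ge0.
by rewrite -real_normK ?num_real//; have := normr_ge0 (resc w t); nra.
Qed.

Lemma bdd_msd (c : sample d m -> 'I_d -> R) : bdd (fun S w => msd w (c S)).
Proof.
apply: bddM; last exact: bdd_sample.
apply: bdd_sum => t; under eq_fun do under eq_fun do rewrite expr2.
by apply: bddM; (apply: bddD; [exact: bdd_resc|exact: bdd_sample]).
Qed.

(** A real-valued form of [Expect] that admits signed integrands. *)
Definition Emean (g : sample d m -> 'rV[R]_d -> R) : R :=
  \sum_(S : sample d m) Dm p S * rsum (fun w => A S w * g S w).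

Let A_ge0 S w : 0 <= A S w. Proof. by have [] := algA S. Qed.

Let summ_A S : summ (A S).
Proof.
have [q0 _ _ q1] := algA S; rewrite /summ; under eq_esum do rewrite ger0_norm//.
by rewrite q1 ltry.
Qed.

Let rsum_A S : rsum (A S) = 1.
Proof. by have [q0 _ _] := algA S; rewrite ge0_rsumE// => -[]. Qed.

Lemma summ_bdd (q g : 'rV[R]_d -> R) (M : R) : summ q -> (forall w, 0 <= q w) ->
  (forall w, q w != 0 -> @Wball R d w) -> (forall w, @Wball R d w -> `|g w| <= M) ->
  summ (fun w => q w * g w).
Proof.
move=> sq q0 qB gM; apply: summ_le (summZ M sq) _ => w.
have [->|qn] := eqVneq (q w) 0; first by rewrite mul0r normr0 mulr0.
by rewrite normrM (ger0_norm (q0 w)) mulrC ler_wpM2r//; apply: gM; exact: qB.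
Qed.

Lemma summ_A_bdd g S : bdd g -> summ (fun w => A S w * g S w).
Proof. by move=> [M gM]; have [_ qB _ _] := algA S; apply: summ_bdd qB (gM S). Qed.

Lemma Expect_Emean g : bdd g -> (forall S w, 0 <= g S w) ->
  Expect p A g = (Emean g)%:E.
Proof.
move=> bg g0; rewrite /Expect /Emean -sumEFin; apply: eq_bigr => S _.
by rewrite EFinM ge0_rsumE//; [exact: summ_A_bdd|move=> w; rewrite mulr_ge0].
Qed.

Lemma EmeanD g h : bdd g -> bdd h ->
  Emean (fun S w => g S w + h S w) = Emean g + Emean h.
Proof.
move=> bg bh; rewrite /Emean -big_split/=; apply: eq_bigr => S _.
rewrite -mulrDr; under eq_fun do rewrite mulrDr.
by rewrite rsumD//; exact: summ_A_bdd.
Qed.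

Lemma EmeanZ c g : Emean (fun S w => c * g S w) = c * Emean g.
Proof.
rewrite /Emean mulr_sumr; apply: eq_bigr => S _.
by under eq_fun do rewrite mulrCA; rewrite rsumZ mulrCA.
Qed.

Lemma Emean_sum (F : 'I_d -> sample d m -> 'rV[R]_d -> R) : (forall t, bdd (F t)) ->
  Emean (fun S w => \sum_t F t S w) = \sum_t Emean (F t).
Proof.
move=> bF; rewrite /Emean exchange_big; apply: eq_bigr => S _ /=.
rewrite -mulr_sumr; under eq_fun do rewrite mulr_sumr.
by rewrite rsum_sum// => t; exact: summ_A_bdd.
Qed.

Lemma Emean_sample (h : sample d m -> R) :
  Emean (fun S _ => h S) = \sum_(S : sample d m) Dm p S * h S.
Proof.
apply: eq_bigr => S _; under eq_fun do rewrite mulrC.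
by rewrite rsumZ rsum_A mulr1.
Qed.

Lemma le_Emean g h : bdd g -> bdd h ->
  (forall S w, A S w != 0 -> g S w <= h S w) -> Emean g <= Emean h.
Proof.
move=> bg bh gh; apply: ler_sum => S _; rewrite ler_pM2l ?Dm_gt0//.
apply: le_rsum => [||w]; [exact: summ_A_bdd..|].
have [->|An] := eqVneq (A S w) 0; first by rewrite !mul0r.
by rewrite ler_wpM2l// gh.
Qed.

Lemma Emean_sqr g : bdd g -> Emean g ^+ 2 <= Emean (fun S w => g S w ^+ 2).
Proof.
move=> bg; set c := Emean g.
have bgg : bdd (fun S w => g S w ^+ 2).
  by under eq_fun do under eq_fun do rewrite expr2; exact: bddM.
(* Integrates [0 <= (g - c)^2] with [c] the mean of [g]. *)
suff : Emean (fun S w => 2 * c * g S w) <=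
    Emean (fun S w => g S w ^+ 2 + (fun=> c ^+ 2) S).
  rewrite EmeanD//; last exact: bdd_sample.
  by rewrite EmeanZ Emean_sample -mulr_suml sum_Dm// -/c; lra.
apply: le_Emean => [||S w _].
- by apply: bddM => //; exact: bdd_sample.
- by apply: bddD => //; exact: bdd_sample.
- by have := sqr_ge0 (g S w - c); lra.
Qed.

Lemma ExpDeltaS_Emean : ExpDeltaS p A = (Emean (fun S w => msd w (emp S)))%:E.
Proof.
rewrite -Expect_Emean => [||S w]; [|exact: bdd_msd|exact: msd_ge0].
by congr Expect; apply/funext => S; apply/funext => w; exact: DeltaS_msd.
Qed.

Lemma ExpDeltaD_Emean : ExpDeltaD p A = (Emean (fun _ w => msd w p))%:E.
Proof.
rewrite -Expect_Emean => [||S w]; [|exact: bdd_msd|exact: msd_ge0].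
by congr Expect; apply/funext => S; apply/funext => w; exact: DeltaD_msd.
Qed.

Lemma dev_emp (S : sample d m) t : dev p S t / m%:R = emp S t - p t.
Proof.
have mn0 : m%:R != 0 :> R by rewrite pnatr_eq0 -lt0n.
rewrite /dev sumrB sumr_const card_ord mulrBl -[p t *+ m]mulr_natr; congr (_ - _).
by rewrite mulfK.
Qed.

(** Claim (ii), used again for the quadratic part in (i). Passing through [emp S],
    [(x + y)^2 <= 2 x^2 + 2 y^2], and each [emp S t] has variance at most [1 / m]. *)
Lemma Emean_msd_le :
  Emean (fun _ w => msd w p) <= 2 * Emean (fun S w => msd w (emp S)) + 2 / m%:R.
Proof.
have mn0 : m%:R != 0 :> R by rewrite pnatr_eq0 -lt0n.
pose h (S : sample d m) : R := 2 * ((\sum_t (dev p S t / m%:R) ^+ 2) / d%:R).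
apply: (@le_trans _ _ (Emean (fun S w => 2 * msd w (emp S) + h S))).
  apply: le_Emean => [||S w _].
  - exact: bdd_msd.
  - apply: bddD (bdd_sample h); apply: bddM; last exact: bdd_msd.
    exact: (bdd_sample (fun=> 2)).
  rewrite /h /msd -mulrDr -mulrDl mulrA ler_wpM2r ?invr_ge0//.
  rewrite -big_split/= mulr_sumr; apply: ler_sum => t _.
  rewrite dev_emp.
  have := sqr_ge0 ((resc w t - emp S t) - (emp S t - p t)); nra.
rewrite EmeanD; last 2 first.
- by apply: bddM; [exact: (bdd_sample (fun=> 2))|exact: bdd_msd].
- exact: bdd_sample.
rewrite EmeanZ lerD2l Emean_sample /h.
under eq_bigr do rewrite mulrCA [X in _ * X]mulrA mulr_sumr.
rewrite -!mulr_sumr ler_pM2l// -mulr_suml.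
rewrite ler_pdivrMr ?ltr0n// exchange_big/=.
apply: (@le_trans _ _ (\sum_(t < d) m%:R^-1)); last first.
  by rewrite sumr_const card_ord mulr_natr.
apply: ler_sum => t _; under eq_bigr do rewrite expr_div_n mulrA.
rewrite -mulr_suml E_dev_sq// ler_pdivrMr ?exprn_gt0 ?ltr0n//.
rewrite expr2 mulKf// ler_piMr ?ler0n//.
by have := sqr_ge0 (p t); lra.
Qed.

Lemma Pw_ge S w : Dm p S * A S w <= Pw p A w.
Proof.
rewrite /Pw (bigD1 S)//= lerDl sumr_ge0// => S' _.
by rewrite mulr_ge0// ltW ?Dm_gt0.
Qed.

Let Pw_ge0 w : 0 <= Pw p A w.
Proof. by apply: sumr_ge0 => S _; rewrite mulr_ge0// ltW ?Dm_gt0. Qed.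

Let Pw_ball w : Pw p A w != 0 -> @Wball R d w.
Proof.
apply: contraNP => nB; rewrite /Pw big1// => S _.
have [_ qB _ _] := algA S; have [->|/qB//] := eqVneq (A S w) 0.
by rewrite mulr0.
Qed.

Let summ_Pw : summ (Pw p A).
Proof. by apply: summ_sum => S; exact: summZ. Qed.

Let rsum_Pw : rsum (Pw p A) = 1.
Proof.
rewrite /Pw rsum_sum => [|S]; last exact: summZ.
by under eq_bigr do rewrite rsumZ rsum_A mulr1; exact: sum_Dm.
Qed.

(* [q ln(q/r) >= q phi + q - r e^phi] pointwise: no Jensen inequality is needed. *)
Lemma KL_ge S (phi : 'rV[R]_d -> R) (M : R) :
  (forall w, @Wball R d w -> `|phi w| <= M) ->
  exists2 k : R, KL (A S) (Pw p A) = k%:E &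
    rsum (fun w => A S w * phi w) + 1 - rsum (fun w => Pw p A w * expR (phi w)) <= k.
Proof.
move=> phiM; set q := A S; set r := Pw p A; set c := Dm p S.
have c0 : 0 < c by exact: Dm_gt0.
have q0 w : 0 <= q w by exact: A_ge0.
have qr w : c * q w <= r w by exact: Pw_ge.
have rp w : q w != 0 -> 0 < q w /\ 0 < r w.
  move=> qn; have qp : 0 < q w by rewrite lt_neqAle eq_sym qn q0.
  by split=> //; rewrite (lt_le_trans _ (qr w))// mulr_gt0.
pose f w := q w * ln (q w / r w).
(* Domination by [|ln c| q + r]: from below [ln x <= x - 1] gives [q ln(q/r) >= q - r]; from above
   [c q <= r] gives [ln(q/r) <= - ln c]. *)
have sf : summ f.
  apply: summ_le (summD (summZ `|ln c| (summ_A S)) summ_Pw) _ => w; rewrite /f -/q -/r.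
  have [->|qn] := eqVneq (q w) 0; first by rewrite mul0r normr0 mulr0 add0r; exact: Pw_ge0.
  have [qp rp'] := rp w qn.
  have qrp : 0 < q w / r w by rewrite divr_gt0.
  rewrite ler_norml; apply/andP; split.
    have : ln (r w / q w) <= r w / q w - 1.
      have := @expR_ge1Dx R (ln (r w / q w)); rewrite lnK ?posrE ?divr_gt0//; lra.
    rewrite -[r w / q w]invf_div lnV ?posrE// => H.
    have := ler_wpM2l (q0 w) H; rewrite invf_div mulrBr mulrCA divff// !mulr1.
    have := mulr_ge0 (normr_ge0 (ln c)) (q0 w); lra.
  apply: (@le_trans _ _ (q w * - ln c)).
    rewrite ler_pM2l// -lnV ?posrE// ler_ln ?posrE ?invr_gt0//.
    by rewrite ler_pdivrMr// -ler_pdivrMl ?invr_gt0// invrK.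
  have := ler_wpM2l (q0 w) (ler_norm (- ln c)); rewrite normrN.
  by have := Pw_ge0 w; rewrite -/r; lra.
exists (rsum f); first by rewrite -rsumE.
have sp : summ (fun w => q w * phi w) by have [_ qB _ _] := algA S; exact: summ_bdd qB phiM.
have se : summ (fun w => r w * expR (phi w)).
  apply: (summ_bdd (M := expR M)) => // w Bw.
  by rewrite ger0_norm ?expR_ge0// ler_expR (le_trans (ler_norm _))// phiM.
rewrite -(rsum_A S) -rsumD// -rsumN -rsumD//; last 2 first.
- exact: summD.
- exact: summN.
apply: le_rsum => //; first by apply: summD; [exact: summD|exact: summN].
move=> w; rewrite /f -/q; have [->|qn] := eqVneq (q w) 0.
  by rewrite !mul0r !add0r oppr_le0 mulr_ge0 ?expR_ge0//; exact: Pw_ge0.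
have [qp rp'] := rp w qn.
have qrp : 0 < q w / r w by rewrite divr_gt0.
(* Multiplied by [q w], the right side of [1 + x <= exp x] becomes [r w * expR (phi w)]. *)
have := @expR_ge1Dx R (phi w - ln (q w / r w)).
rewrite expRD expRN lnK ?posrE// invf_div => /(ler_wpM2l (q0 w)).
rewrite mulrCA [q w * (_ / _)]mulrCA divff// mulr1 !mulrDr mulrN; lra.
Qed.

(** Donsker-Varadhan bound: averaging [KL_ge] over [S], the exponential terms form a mean under the
    product of the two marginals, which is at most 1 and is offset by the [+ 1]. *)
Lemma MI_ge (phi : sample d m -> 'rV[R]_d -> R) : bdd phi ->
  (forall w, \sum_(S : sample d m) Dm p S * expR (phi S w) <= 1) ->
  ((Emean phi)%:E <= MI p A)%E.
Proof.
move=> [M phiM] phi1.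
have H S := KL_ge S (phiM S).
apply: (@le_trans _ _ (\sum_(S : sample d m) (Dm p S *
    (rsum (fun w => A S w * phi S w) + 1
      - rsum (fun w => Pw p A w * expR (phi S w))))%:E)%E); last first.
  apply: lee_sum => S _; have [k -> kge] := H S.
  by rewrite -EFinM lee_fin ler_pM2l ?Dm_gt0.
rewrite sumEFin lee_fin.
under [leRHS]eq_bigr do rewrite mulrBr mulrDr mulr1.
rewrite sumrB big_split/= sum_Dm// -/(Emean phi) -addrA lerDl subr_ge0.
have se S : summ (fun w => Pw p A w * expR (phi S w)).
  apply: (summ_bdd (M := expR M)) => // w Bw.
  by rewrite ger0_norm ?expR_ge0// ler_expR (le_trans (ler_norm _))// phiM.
under eq_bigr do rewrite -rsumZ.
rewrite -rsum_sum; last by move=> S; exact: summZ.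
rewrite -rsum_Pw; apply: le_rsum => //.
  by apply: summ_sum => S; exact: summZ.
move=> w; under eq_bigr do rewrite mulrCA.
by rewrite -mulr_sumr ler_piMr.
Qed.

End Algorithm.

(** * Integration by parts over the cube of biases *)

Section Fingerprinting.
Context {R : realType}.

Lemma poly_primitive (P : {poly R}) : exists Q : {poly R}, deriv Q = P.
Proof.
exists (\poly_(i < (size P).+1) (P`_i.-1 / i%:R)); apply/polyP => i.
rewrite coef_deriv coef_poly ltnS /=; case: ltnP => iP.
  by rewrite -[LHS]mulr_natr divfK// pnatr_eq0.
by rewrite mul0rn nth_default.
Qed.

(* Iterating the mean value theorem coordinate by coordinate replaces the average
   of a sum of product polynomials over the cube by its value at one point. *)
Lemma cube_mean_value (d : nat) (J : finType) (Q : J -> 'I_d -> {poly R}) (a b : R) :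
  a < b -> (forall j, exists u, (Q j u).[a] = (Q j u).[b]) ->
  exists p : 'I_d -> R, (forall u, a <= p u <= b) /\
    \sum_j \prod_u (deriv (Q j u)).[p u] = 0.
Proof.
move=> ab Qab; pose av j u := ((Q j u).[b] - (Q j u).[a]) / (b - a).
(* Hybrid sums: the first [k] factors are evaluated at [p], the others averaged over [[a, b]]. At
   [k = 0] every product contains a zero average. *)
suff H k : (k <= d)%N -> exists p : 'I_d -> R, (forall u, a <= p u <= b) /\
    \sum_j \prod_(u < d) (if (u < k)%N then (deriv (Q j u)).[p u] else av j u) = 0.
  have [p [pab p0]] := H d (leqnn d); exists p; split=> //.
  rewrite -[RHS]p0; apply: eq_bigr => j _; apply: eq_bigr => u _.
  by rewrite ltn_ord.
elim: k => [_|k IH kd].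
  exists (fun=> a); split=> [u|]; first by rewrite lexx ltW.
  rewrite big1// => j _; have [u Qu] := Qab j.
  by rewrite (bigD1 u)//= /av Qu subrr !mul0r.
have [p [pab p0]] := IH (ltnW kd); pose v := Ordinal kd.
pose c j := \prod_(u < d | u != v)
  (if (u < k)%N then (deriv (Q j u)).[p u] else av j u).
(* With the factors other than [v] frozen in [c], the hybrid sum is the mean slope of [G], attained
   by its derivative at some [x]. *)
pose G := \sum_j c j *: Q j v.
have [x xab Gx] := polyrcf.poly_mvt G ab.
exists (fun u => if u == v then x else p u); split=> [u|].
  by case: eqP => // _; have := xab; rewrite in_itv/= => /andP[/ltW-> /ltW->].
have -> : \sum_j \prod_(u < d) (if (u < k.+1)%N
    then (deriv (Q j u)).[if u == v then x else p u] else av j u) = (deriv G).[x].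
  rewrite /G raddf_sum/= horner_sum; apply: eq_bigr => j _.
  rewrite derivZ hornerZ mulrC (bigD1 v)//= ltnSn eqxx; congr (_ * _).
  apply: eq_bigr => u uv; rewrite (negPf uv) ltnS leq_eqVlt.
  by rewrite (_ : (u == k :> nat) = false)//; apply: negbTE.
have ba : b - a != 0 by rewrite subr_eq0 gt_eqF.
apply: (mulIf ba); rewrite -Gx mul0r -[RHS](mul0r (b - a)) -[in RHS]p0.
rewrite /G !horner_sum -sumrB mulr_suml; apply: eq_bigr => j _.
by rewrite !hornerZ (bigD1 v)//= ltnn -/(c j) /av; field.
Qed.

Definition bernp (x : bool) : {poly R} := 2^-1 *: (1 + (sgb x) *: 'X).

Lemma bernpE x q : (bernp x).[q] = bern q x.
Proof. by rewrite /bernp /bern /sgb !hornerE; case: x; field. Qed.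

(** The score identity. It holds for one factor because [sgb x] squares to 1, and passes to products
    by the Leibniz rule. *)
Lemma deriv_prod_bernp m (x : 'I_m -> bool) (q : R) :
  (1 - q ^+ 2) * (deriv (\prod_i bernp (x i))).[q] =
  (\prod_i bernp (x i)).[q] * \sum_i (sgb (x i) - q).
Proof.
elim: (index_enum _) => [|i r IH].
  by rewrite !big_nil derivC hornerE !mulr0.
have B : (1 - q ^+ 2) * (deriv (bernp (x i))).[q] = (bernp (x i)).[q] * (sgb (x i) - q).
  rewrite /bernp !poly.derivE !hornerE /= /sgb.
  by case: (x i); field.
rewrite !big_cons derivM hornerD !hornerM mulrDr mulrA B mulrCA IH.
by ring.
Qed.

(** If the means of [w] track [p] over the whole cube, they must vary with [p]; by the score
    identity this variation is a correlation of [w] with [dev]. *)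
Lemma fingerprinting (d m : nat) (w : sample d m -> 'I_d -> R) :
  (forall p, @pcube R d p ->
    \sum_t (\sum_(S : sample d m) Dm p S * w S t - p t) ^+ 2 <= d%:R / 54) ->
  exists2 p, @pcube R d p & d%:R / 54 <=
    \sum_t (1 / 9 - p t ^+ 2) / (1 - p t ^+ 2) *
      \sum_(S : sample d m) Dm p S * (w S t * dev p S t).
Proof.
move=> wp.
pose h (S : sample d m) t := \prod_(i < m) bernp (S i t).
(* The factor [1/9 - X^2] vanishes at both ends of the interval. The term [- X / 3] contributes
   [p^2 - 1/27] to the derivative, 1/27 being the mean of [p^2] over the interval. *)
pose k (S : sample d m) t :=
  ((1 / 9)%:P - 'X ^+ 2) * ((w S t)%:P - (1 / 3) *: 'X) * h S t.
have [H HE] := choice poly_primitive.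
(* The product of derivatives differentiates [k] in coordinate [t] and restores the likelihood [h]
   in all the others. *)
pose Q (j : 'I_d * sample d m) u := if u == j.1 then k j.2 u else H (h j.2 u).
have ab : - (1 / 3) < 1 / 3 :> R by lra.
have [|p [pC p0]] := @cube_mean_value d _ Q _ _ ab.
  move=> [t S]; exists t; rewrite /Q eqxx /k /= !hornerM.
  suff E x : x ^+ 2 = 1 / 9 -> ((1 / 9)%:P - 'X ^+ 2 : {poly R}).[x] = 0.
    by rewrite !E ?mul0r//; lra.
  by move=> xE; rewrite !hornerE xE; lra.
exists p => //.
have DmE S : Dm p S = \prod_t (h S t).[p t].
  rewrite /Dm /Dprob exchange_big; apply: eq_bigr => t _.
  by rewrite /h horner_prod; apply: eq_bigr => i _; rewrite bernpE.
pose a t := (1 / 9 - p t ^+ 2) / (1 - p t ^+ 2).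
pose g t := \sum_(S : sample d m) Dm p S * w S t.
have QE t S : \prod_u (deriv (Q (t, S) u)).[p u] =
    Dm p S * (p t ^+ 2 - 1 / 27) - 2 * p t * (Dm p S * w S t) +
    a t * (Dm p S * (w S t * dev p S t)) - a t * p t / 3 * (Dm p S * dev p S t).
  have pt : 1 - p t ^+ 2 != 0 by have /andP[] := pC t => ? ?; rewrite gt_eqF//; nra.
  rewrite (bigD1 t)//=.
  rewrite [X in _ * X](eq_bigr (fun u => (h S u).[p u])) => [|u /negPf ut]; last first.
    by rewrite /Q /= ut HE.
  rewrite !DmE [\prod_t (h S t).[p t]](bigD1 t)//=.
  have hE : (deriv (h S t)).[p t] = (h S t).[p t] * dev p S t / (1 - p t ^+ 2).
    by apply: (mulfI pt); rewrite deriv_prod_bernp [RHS]mulrC divfK.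
  rewrite /Q /= eqxx /k !derivM !hornerD !hornerM hE !poly.derivE !hornerE/= /a.
  by field.
have E0 : \sum_t (p t ^+ 2 - 1 / 27 - 2 * p t * g t +
    a t * \sum_(S : sample d m) Dm p S * (w S t * dev p S t)) = 0.
  rewrite -[RHS]p0 (eq_bigr (fun j => \prod_u (deriv (Q (j.1, j.2) u)).[p u])); last by case.
  rewrite -(pair_bigA _ (fun t S => \prod_u (deriv (Q (t, S) u)).[p u]))/=.
  apply: eq_bigr => t _; under [RHS]eq_bigr do rewrite QE.
  rewrite sumrB !big_split/= sumrN -mulr_suml -!mulr_sumr sum_Dm// E_dev//.
  by rewrite mulr0 subr0 [1 * (_ - _)]mul1r.
(* Dropping [g t ^+ 2] completes the square. The assumption on [w] then takes at most [d / 54] from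
   [d / 27]. *)
have sq t : 1 / 27 - (g t - p t) ^+ 2 <= - (p t ^+ 2 - 1 / 27 - 2 * p t * g t).
  by have := sqr_ge0 (g t); lra.
have := wp p pC; rewrite -/g.
move: E0; rewrite big_split/= => /eqP; rewrite addrC addr_eq0 => /eqP ->.
rewrite -sumrN => gp; apply: le_trans (ler_sum _ (fun t _ => sq t)).
rewrite sumrB sumr_const card_ord -mulr_natr; lra.
Qed.

End Fingerprinting.

(** * Lower bound on the mutual information *)

Section LowerBound.
Context {R : realType} {d m : nat}.
Hypotheses (d_gt0 : (0 < d)%N) (m_gt0 : (0 < m)%N).
Variable A : sample d m -> 'rV[R]_d -> R.
Hypotheses (algA : algorithm A).
Hypothesis A_small : forall S w, A S w != 0 -> DeltaS S w <= 1 / 54.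

Let dn0 : d%:R != 0 :> R. Proof. by rewrite pnatr_eq0 -lt0n. Qed.
Let d0 : 0 < d%:R :> R. Proof. by rewrite ltr0n. Qed.
Let m0 : 0 < m%:R :> R. Proof. by rewrite ltr0n. Qed.

Let mean_resc S t := rsum (fun w => A S w * resc w t).

Let bdd_err (c : sample d m -> 'I_d -> R) t :
  bdd (fun S w => resc w t - c S t).
Proof. by apply: bddD; [exact: bdd_resc|exact: (bdd_sample (fun S => - c S t))]. Qed.

(** As [emp] is unbiased for [p], each difference is the mean of [resc - emp]; its square is at most
    the mean square, and these sum to [d] times the mean of [DeltaS]. *)
Lemma mean_resc_close p : @pcube R d p ->
  \sum_t (\sum_(S : sample d m) Dm p S * mean_resc S t - p t) ^+ 2 <= d%:R / 54.
Proof.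
move=> pC; pose err t (S : sample d m) (w : 'rV[R]_d) := resc w t - emp S t.
have errE t : \sum_(S : sample d m) Dm p S * mean_resc S t - p t = Emean p A (err t).
  rewrite /err EmeanD//; [|exact: bdd_resc|exact: (bdd_sample (fun S => - emp S t))].
  congr (_ + _); rewrite (Emean_sample p algA (fun S => - emp S t)).
  under eq_bigr do rewrite mulrN.
  rewrite sumrN; congr (- _).
  transitivity (\sum_(S : sample d m) (Dm p S * p t + Dm p S * dev p S t / m%:R)).
    by rewrite big_split/= -!mulr_suml sum_Dm E_dev mul0r addr0 mul1r.
  by apply: eq_bigr => S _; rewrite -mulrA dev_emp//; ring.
have berr t : bdd (fun S w => err t S w ^+ 2).
  by under eq_fun do under eq_fun do rewrite expr2; apply: bddM; exact: bdd_err.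
apply: (@le_trans _ _ (\sum_t Emean p A (fun S w => err t S w ^+ 2))).
  by apply: ler_sum => t _; rewrite errE Emean_sqr//; exact: bdd_err.
rewrite -Emean_sum//.
have -> : d%:R / 54 = Emean p A (fun S _ => (fun=> d%:R / 54) S).
  by rewrite Emean_sample// -mulr_suml sum_Dm// mul1r.
apply: le_Emean => // [||S w Sw]; [exact: bdd_sum|exact: bdd_sample|].
have := A_small Sw; rewrite DeltaS_msd// /msd ler_pdivrMr//.
by rewrite [1 / 54 * _]mulrC mul1r.
Qed.

Lemma MI_lower_bound : exists2 p, @pcube R d p &
  ((1 / 11664 * d%:R / (m%:R * fine (ExpDeltaS p A) + 1))%:E <= MI p A)%E.
Proof.
have [p pC fp] := fingerprinting mean_resc_close; exists p => //.
rewrite ExpDeltaS_Emean//=; set eps := Emean p A _.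
have eps0 : 0 <= eps.
  apply: sumr_ge0 => S _; rewrite mulr_ge0 ?(ltW (Dm_gt0 pC _))//.
  apply: rsum_ge0 => w; rewrite mulr_ge0 ?msd_ge0//.
  by have [] := algA S.
set K := _ + 1; have K0 : 0 < K by rewrite ltr_wpDl// mulr_ge0// ltW.
pose a t := (1 / 9 - p t ^+ 2) / (1 - p t ^+ 2).
have a9 t : a t ^+ 2 <= 1 / 81.
  have /andP[p1 p2] := pC t.
  have : 0 <= a t by rewrite divr_ge0; nra.
  have : a t <= 1 / 9 by rewrite ler_pdivrMr; nra.
  nra.
(* The maximiser of [l d / 54 - l^2 d K], with maximum [d / (108^2 K)] and [108^2 = 11664]. *)
pose l := 1 / (108 * K).
pose s (w : 'rV[R]_d) t := l * a t * (resc w t - p t).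
pose phi (S : sample d m) w :=
  \sum_t s w t * dev p S t + (- (4 * m%:R)) * \sum_t s w t ^+ 2.
have bs t : bdd (fun (_ : sample d m) w => s w t).
  by apply: bddM; [exact: (bdd_sample (fun=> _))|exact: (bdd_err (fun=> p))].
have bsd t : bdd (fun (S : sample d m) w => s w t * dev p S t).
  by apply: bddM => //; exact: (bdd_sample (fun S => dev p S t)).
have bss : bdd (fun (_ : sample d m) w => \sum_t s w t ^+ 2).
  by apply: bdd_sum => t; under eq_fun do under eq_fun do rewrite expr2; exact: bddM.
have bphi2 : bdd (fun (_ : sample d m) w => - (4 * m%:R) * \sum_t s w t ^+ 2).
  by apply: bddM => //; exact: (bdd_sample (fun=> _)).
apply: le_trans (_ : ((Emean p A phi)%:E <= _)%E); last first.
  apply: MI_ge => // [|w]; first by apply: bddD => //; exact: bdd_sum.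
  (* For fixed [w] the vector [s w] is constant, so the quadratic term of [phi] cancels exactly the
     bound of [sample_mgf]. *)
  under eq_bigr do rewrite /phi expRD mulrA.
  rewrite -mulr_suml mulNr expRN ler_pdivrMr ?expR_gt0// mul1r.
  exact: sample_mgf.
rewrite lee_fin /phi EmeanD//; last exact: bdd_sum.
rewrite (EmeanZ p A _ (fun _ w => \sum_t s w t ^+ 2)) Emean_sum//.
(* The centring [p t] contributes nothing since [dev] has mean zero; what is left is [l] times the
   fingerprinting sum. *)
have lin : l * (d%:R / 54) <= \sum_t Emean p A (fun S w => s w t * dev p S t).
  apply: le_trans (ler_wpM2l _ fp) _; first by rewrite divr_ge0// mulr_ge0// ltW.
  rewrite mulr_sumr; apply: ler_sum => t _; rewrite -/(a t) le_eqVlt; apply/orP; left.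
  have -> : (fun (S : sample d m) w => s w t * dev p S t) =
     (fun S w => l * a t * (resc w t * dev p S t + (- p t * dev p S t))).
    by apply/funext => S; apply/funext => w; rewrite /s; ring.
  rewrite EmeanZ (@EmeanD _ _ _ p A algA (fun S w => resc w t * dev p S t)
     (fun S _ => - p t * dev p S t))//; last 2 first.
  - by apply: bddM; [exact: bdd_resc|exact: (bdd_sample (fun S => dev p S t))].
  - exact: (bdd_sample (fun S => - p t * dev p S t)).
  rewrite (Emean_sample p algA (fun S => - p t * dev p S t)).
  under [X in _ + X]eq_bigr do rewrite mulrCA.
  rewrite -mulr_sumr E_dev// mulr0 addr0 mulrA; apply/eqP; congr (_ * _).
  apply: eq_bigr => S _; congr (_ * _).
  by rewrite /mean_resc mulrC -rsumZ; congr rsum; apply/funext => w; ring.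
(* With [a t ^+ 2 <= 1 / 81] and a mean of [msd w p] of at most [2 eps + 2 / m], the left side is at
   most [8 / 81] of the right. *)
have quad : 4 * m%:R * Emean p A (fun _ w => \sum_t s w t ^+ 2) <= l ^+ 2 * d%:R * K.
  apply: (@le_trans _ _ (4 * m%:R *
      Emean p A (fun _ w => l ^+ 2 * d%:R / 81 * msd w p))).
    rewrite ler_wpM2l ?mulr_ge0 ?(ltW m0)//; apply: le_Emean => // [|S w _].
      by apply: bddM; [exact: (bdd_sample (fun=> _))|exact: (bdd_msd (fun=> p))].
    have -> : l ^+ 2 * d%:R / 81 * msd w p = \sum_t l ^+ 2 / 81 * (resc w t - p t) ^+ 2.
      by rewrite -mulr_sumr /msd; field.
    apply: ler_sum => t _; rewrite /s exprMn ler_wpM2r ?sqr_ge0//.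
    by rewrite [(l * a t) ^+ 2]exprMn ler_wpM2l ?sqr_ge0// -div1r; exact: a9.
  rewrite EmeanZ; have := Emean_msd_le d_gt0 m_gt0 pC algA; rewrite -/eps => H.
  have lK := mulr_ge0 (sqr_ge0 l) (ltW d0).
  apply: (@le_trans _ _ (4 * m%:R * (l ^+ 2 * d%:R / 81 * (2 * eps + 2 / m%:R)))).
    by rewrite ler_wpM2l ?mulr_ge0 ?(ltW m0)// ler_wpM2l// divr_ge0.
  have -> : 4 * m%:R * (l ^+ 2 * d%:R / 81 * (2 * eps + 2 / m%:R)) =
      l ^+ 2 * d%:R * (8 / 81 * K) by rewrite /K; field; rewrite gt_eqF.
  by rewrite ler_wpM2l//; lra.
rewrite mulNr; apply: le_trans (lerB lin quad).
by rewrite le_eqVlt; apply/orP; left; apply/eqP; rewrite /l; field; rewrite gt_eqF.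
Qed.

End LowerBound.

(** * Deduction of claims (i) and (ii) *)

Theorem theorem2 (R : realType) :
  (* (i) *)
  (exists (c : R) (k : nat), 0 < c /\
    forall (d m : nat), (1 <= d)%N -> (3 < m)%N ->
    forall A : sample d m -> 'rV[R]_d -> R, algorithm A ->
    exists p : 'I_d -> R, @pcube R d p /\
      ((forall (S : sample d m) (w : 'rV[R]_d), A S w != 0 -> DeltaS S w <= 1 / 54) ->
       ((c * d%:R / ((m%:R * fine (ExpDeltaS p A) + 1) ^+ 5
                      * (1 + ln (m%:R + d%:R)) ^+ k))%:E <= MI p A)%E)) /\
  (* (ii) *)
  (exists (C : R) (k : nat), 0 < C /\
    forall (d m : nat), (1 <= d)%N -> (1 <= m)%N ->
    forall (A : sample d m -> 'rV[R]_d -> R) (p : 'I_d -> R),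
      algorithm A -> @pcube R d p ->
      (ExpDeltaD p A <=
        (C * (fine (ExpDeltaS p A) + 1 / m%:R) * (1 + ln (m%:R + d%:R)) ^+ k)%:E)%E).
Proof.
split.
- exists (1 / 11664), 0%N; split; first by lra.
  move=> d m d0 m3 A algA.
  have m0 : (0 < m)%N by exact: leq_trans m3.
  (* If some output has excess above 1/54, the implication is vacuous and the zero bias serves as
     [p]. *)
  have [Asmall|nA] := pselect
    (forall (S : sample d m) w, A S w != 0 -> DeltaS S w <= 1 / 54); last first.
    by exists (fun=> 0); split=> // t; lra.
  have [p pC pMI] := MI_lower_bound d0 m0 algA Asmall.
  exists p; split=> // _; apply: le_trans pMI; rewrite lee_fin expr0 mulr1.
  have eps0 : 0 <= fine (ExpDeltaS p A).
    apply: fine_ge0; apply: sume_ge0 => S _; rewrite mule_ge0 ?lee_fin ?(ltW (Dm_gt0 pC _))//.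
    apply: esum_ge0 => w _; have [A0 _ _ _] := algA S.
    by rewrite lee_fin DeltaS_msd// mulr_ge0 ?msd_ge0.
  (* A base of at least 1 is below its fifth power, so the bound with the first power implies the
     stated one. *)
  have K1 : 1 <= m%:R * fine (ExpDeltaS p A) + 1 by rewrite lerDr mulr_ge0.
  have K0 := lt_le_trans ltr01 K1.
  have cd : 0 <= 1 / 11664 * d%:R :> R by have := ler0n R d; lra.
  rewrite ler_wpM2l// lef_pV2 ?posrE ?exprn_gt0//.
  by rewrite ler_eXnr.
- exists 2, 0%N; split=> // d m d0 m0 A p algA pC.
  rewrite ExpDeltaD_Emean// ExpDeltaS_Emean// lee_fin expr0 mulr1 mulrDr mulrA mulr1.
  exact: Emean_msd_le.
Qed.
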